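(* For every integer $n\ge 0$, as polynomials in $y$, $$\sum_{k=0}^{n}\det\begin{pmatrix} M_{n,k}(y,y) & M_{n,k+1}(y,y)\\ M_{n+2,k}(y,y) & M_{n+2,k+1}(y,y)\end{pmatrix}=2\,M_{n,0}(y,y)\,M_{n+1,0}(y,y).$$
   Context: A partial Motzkin path from $(0,0)$ to $(n,k)$ is a lattice path that never goes below the $X$-axis and consists of up steps $U=(1,1)$, down steps $D=(1,-1)$ and horizontal steps $H=(1,0)$. In a weighted partial Motzkin path, every up step and every down step has weight $1$, every horizontal step lying on the $X$-axis has weight $x$, and every horizontal step not lying on the $X$-axis has weight $y$; the weight of a path is the product of the weights of its steps. $M_{n,k}(x,y)$ is the sum of the weights of all partial Motzkin paths from $(0,0)$ to $(n,k)$. Equivalently, $M_{0,0}(x,y)=1$, $M_{n,k}(x,y)=0$ if $n<k$ or $k<0$, $M_{n,0}(x,y)=xM_{n-1,0}(x,y)+M_{n-1,1}(x,y)$ for $n\ge1$, and $M_{n,k}(x,y)=M_{n-1,k-1}(x,y)+yM_{n-1,k}(x,y)+M_{n-1,k+1}(x,y)$ for $n\ge k\ge 1$. $M_{n,k}(y,y)$ denotes the polynomial obtained by substituting $x=y$. *)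

(* Defs.v *)
From HB Require Import structures.
From mathcomp Require Import all_boot all_order all_algebra.
Set Implicit Arguments.
Unset Strict Implicit.
Unset Printing Implicit Defensive.
Import Order.TTheory GRing.Theory Num.Theory.
Local Open Scope ring_scope.

Inductive step := Up | Down | Horiz.

Definition ord3_of_step (s : step) : 'I_3 :=
  match s with
  | Up => @Ordinal 3 0 isT
  | Down => @Ordinal 3 1 isT
  | Horiz => @Ordinal 3 2 isT
  end.
Definition step_of_ord3 (i : 'I_3) : step :=
  match val i with 0%N => Up | 1%N => Down | _ => Horiz end.
Lemma ord3_of_stepK : cancel ord3_of_step step_of_ord3.
Proof. by case. Qed.
HB.instance Definition _ := Finite.copy step (can_type ord3_of_stepK).

Definition rise (s : step) : int :=
  match s with Up => 1 | Down => -1 | Horiz => 0 end.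

Definition height (p : seq step) : int := \sum_(s <- p) rise s.

(* A path from (0,0) is encoded by its steps; its i-th vertex is
   (i, height (take i p)). *)
Definition partial_motzkin (n k : nat) (p : n.-tuple step) : bool :=
  [forall i : 'I_n.+1, 0 <= height (take i p)] && (height p == k%:Z).

(* Z[x, y] is represented as Z[y][x]: x is 'X and y is 'X%:P. *)
Definition step_weight (h : int) (s : step) : {poly {poly int}} :=
  match s with
  | Up | Down => 1
  | Horiz => if h == 0 then 'X else 'X%:P
  end.

Definition path_weight (n : nat) (p : n.-tuple step) : {poly {poly int}} :=
  \prod_(i < n) step_weight (height (take i p)) (tnth p i).

Definition M (n k : nat) : {poly {poly int}} :=
  \sum_(p : n.-tuple step | partial_motzkin k p) path_weight p.

(* M_{n,k}(y, y) in Z[y]: evaluating at 'X : {poly int} substitutes y for x. *)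
Definition Myy (n k : nat) : {poly int} := (M n k).['X].

Definition mx2 (R : Type) (a b c d : R) : 'M[R]_2 :=
  \matrix_(i, j) if i == 0 then (if j == 0 then a else b)
                 else (if j == 0 then c else d).

(* Main.v *)
(* On the line x = y the columns satisfy M_{n+1} = T M_n for one tridiagonal
   operator T, independent of the height. Writing a = M_n, b = T a and c = T b, the sum of the
   minors a_k c_{k+1} - a_{k+1} c_k telescopes for an arbitrary sequence a;
   the boundary terms at the top vanish because a_k = 0 for k > n, and those at
   the bottom add up to a_0 b_0 + a_0 (a_1 + y a_0) = 2 a_0 b_0. *)
Require Import Defs.
From mathcomp Require Import all_boot all_order all_algebra.
From mathcomp Require Import zify ring.
Local Open Scope ring_scope.
Import Order.TTheory GRing.Theory Num.Theory.

Lemma det_mx2 (R : comNzRingType) (a b c d : R) :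
  \det (mx2 a b c d) = a * d - b * c.
Proof.
rewrite (expand_det_row _ ord0) !big_ord_recl big_ord0 /cofactor !det_mx11.
by rewrite !mxE /= expr0 expr1; ring.
Qed.

Definition motzkin_step {R : comNzRingType} (y : R) (a : nat -> R) (k : nat) : R :=
  (if k is j.+1 then a j else 0) + y * a k + a k.+1.

(** Keeping every top boundary term explicit is what lets the induction on [N] close for arbitrary
    [a]. *)
Lemma sum_minors_motzkin_step (R : comNzRingType) (y : R) (a : nat -> R) (N : nat) :
  let b := motzkin_step y a in
  let c := motzkin_step y b in
  \sum_(0 <= k < N.+1) (a k * c k.+1 - a k.+1 * c k) =
  2%:R * a 0%N * b 0%N
  - a N.+1 * b N.+1 + a N.+2 * b N
  + (a N * a N.+3 - a N.+1 * a N.+2)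
  + y * (a N * a N.+2 - a N.+1 ^+ 2).
Proof.
elim: N => [|N IHN] b c.
  by rewrite big_nat1 /c /b /motzkin_step; ring.
rewrite big_nat_recr //= IHN /c /b /motzkin_step.
(* The lower neighbour in [motzkin_step] is stuck on a variable index until [N] is split. *)
by case: N {IHN} => [|N]; ring.
Qed.

(** Paths are split at their last step, since the recurrence varies the final height. *)
Lemma big_tuple_rcons (R : nmodType) (T : finType) (n : nat)
    (F : n.+1.-tuple T -> R) :
  \sum_(p : n.+1.-tuple T) F p =
  \sum_(s : T) \sum_(q : n.-tuple T) F [tuple of rcons q s].
Proof.
rewrite pair_big /= (reindex (fun sq : T * n.-tuple T => [tuple of rcons sq.2 sq.1])) //=.
apply: onW_bij; apply: inj_card_bij => [[s q] [t r] /= eq_sq|].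
  have /rcons_inj [eq_qr ->] := congr1 val eq_sq.
  by congr (_, _); apply: val_inj.
by rewrite card_prod !card_tuple expnS.
Qed.

Lemma big_step (R : nmodType) (F : step -> R) :
  \sum_(s : step) F s = F Up + F Down + F Horiz.
Proof.
rewrite (bigD1 Up) // (bigD1 Down) // (bigD1 Horiz) //=.
by rewrite big1 ?addr0 ?addrA //; case.
Qed.

(** Once [x = y], the weight of a step no longer depends on its height, so path weights are
    multiplicative under [rcons]. *)
Definition yweight (s : step) : {poly int} := if s is Horiz then 'X else 1.

(** Stated on sequences, free of the length index, so that it can be decomposed along [rcons]. *)
Definition nonneg_path (p : seq step) : bool :=
  all (fun i => 0 <= height (take i p)) (iota 0 (size p).+1).

Lemma partial_motzkinE (n k : nat) (p : n.-tuple step) :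
  partial_motzkin k p = nonneg_path p && (height p == k%:Z).
Proof.
rewrite /partial_motzkin /nonneg_path size_tuple; congr (_ && _).
apply/forallP/allP => [H i | H i].
  by rewrite mem_iota /= add0n => lt_i; exact: (H (Ordinal lt_i)).
by apply: H; rewrite mem_iota /= add0n.
Qed.

Lemma height_rcons (p : seq step) (s : step) :
  height (rcons p s) = height p + rise s.
Proof. by rewrite /height -cats1 big_cat big_seq1. Qed.

Lemma nonneg_path_rcons (p : seq step) (s : step) :
  nonneg_path (rcons p s) = nonneg_path p && (0 <= height p + rise s).
Proof.
rewrite /nonneg_path size_rcons -[in LHS]addn1 iotaD all_cat all_seq1 add0n.
rewrite (@take_oversize _ (size p).+1) ?size_rcons // height_rcons.
congr (_ && _).
apply: eq_in_all => i; rewrite mem_iota add0n ltnS => le_i.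
by rewrite -cats1 takel_cat.
Qed.

Lemma nonneg_path_height (p : seq step) : nonneg_path p -> 0 <= height p.
Proof.
move/allP => /(_ (size p)); rewrite take_size; apply.
by rewrite mem_iota /= add0n.
Qed.

Lemma MyyE (n k : nat) :
  Myy n k = \sum_(p : n.-tuple step)
    if nonneg_path p && (height p == k%:Z) then \prod_(s <- p) yweight s else 0.
Proof.
rewrite /Myy /M horner_sum big_mkcond; apply: eq_bigr => p _.
rewrite partial_motzkinE; case: ifP => // _.
rewrite /path_weight horner_prod big_tuple; apply: eq_bigr => i _.
by case: (tnth p i); rewrite /= ?hornerE //; case: ifP; rewrite hornerE.
Qed.

Lemma MyyS (n k : nat) : Myy n.+1 k = motzkin_step 'X (Myy n) k.
Proof.
rewrite MyyE big_tuple_rcons big_step /motzkin_step -addrA [RHS]addrAC -addrA.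
have weight_rcons (q : n.-tuple step) s :
    \prod_(t <- rcons q s) yweight t = (\prod_(t <- q) yweight t) * yweight s.
  by rewrite big_rcons /= mulrC.
(* Paths to height [k] with last step [s] are the paths to height [k - rise s] followed by [s]; the
   last vertex is nonnegative because [k] is. *)
have M_ext (s : step) (j : nat) : j%:Z = k%:Z - rise s ->
  \sum_(q : n.-tuple step)
    (if nonneg_path (rcons q s) && (height (rcons q s) == k%:Z)
     then \prod_(t <- rcons q s) yweight t else 0) = Myy n j * yweight s.
  move=> eq_j; rewrite MyyE mulr_suml; apply: eq_bigr => q _.
  rewrite nonneg_path_rcons height_rcons weight_rcons.
  have -> : (height q == j%:Z) = (height q + rise s == k%:Z).
    by rewrite eq_j eq_sym subr_eq eq_sym.
  case: eqP => [->|_]; first by rewrite !andbT; case: ifP; rewrite ?mul0r.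
  by rewrite !andbF mul0r.
rewrite (M_ext Down k.+1) ?(M_ext Horiz k) /=; [|lia|lia].
rewrite mulr1 [_ * 'X]mulrC; congr (_ + _).
case: k M_ext => [|k] M_ext; last by rewrite (M_ext Up k) ?mulr1 //=; lia.
(* Reaching height 0 by an up step would require a path ending at height -1. *)
rewrite big1 // => q _; rewrite nonneg_path_rcons height_rcons /=.
case: ifP => // /andP [/andP [/nonneg_path_height q_ge0 _] /eqP]; lia.
Qed.

Lemma Myy_eq0 (n k : nat) : (n < k)%N -> Myy n k = 0.
Proof.
elim: n k => [|n IHn] k lt_nk.
  rewrite MyyE big1 // => p _; rewrite [p]tuple0 /height big_nil.
  by case: k lt_nk => // k _; rewrite andbF.
rewrite MyyS; case: k lt_nk => // k lt_nk.
by rewrite /motzkin_step !IHn ?mulr0 ?addr0 //; lia.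
Qed.

Theorem theorem3p11 (n : nat) :
  \sum_(0 <= k < n.+1)
     \det (mx2 (Myy n k) (Myy n k.+1)
               (Myy n.+2 k) (Myy n.+2 k.+1))
  = 2%:R * Myy n 0 * Myy n.+1 0.
Proof.
have M2 k : Myy n.+2 k = motzkin_step 'X (motzkin_step 'X (Myy n)) k.
  (* [MyyS] is a pointwise equation, so the inner operator is unfolded at each of its indices. *)
  by rewrite MyyS /motzkin_step; case: k => [|k]; rewrite !MyyS.
under eq_bigr do rewrite det_mx2 !M2.
rewrite sum_minors_motzkin_step -!MyyS.
(* Each top boundary term has a factor [Myy n j] with [j] among [n.+1], [n.+2], [n.+3]. *)
by rewrite (@Myy_eq0 n n.+1) ?(@Myy_eq0 n n.+2) ?(@Myy_eq0 n n.+3) //; [ring|lia..].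
Qed.
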